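(* Let $(\rho,\vec v,T,\vec B,\psi)^T$ be the primitive state at a solid-wall boundary node $(-)$, with $\rho>0$, $T>0$, let $\vec n$ be the unit outward normal, $\vec v^{\,\mathrm w}$ the wall velocity ($\vec v^{\,\mathrm w}\cdot\vec n=0$) and $\vec B^0$ the external magnetic field. Let the ghost state be either $$\mathbf v^{\nu,\mathrm{ins}}_{(+)}=(\rho,\,-\vec v+2\vec v^{\,\mathrm w},\,T,\,-\vec B+2\vec B^0,\,\psi)^T\qquad\text{(electrically insulating wall)}$$ or $$\mathbf v^{\nu,\mathrm{cond}}_{(+)}=(\rho,\,-\vec v+2\vec v^{\,\mathrm w},\,T,\,\vec B,\,\psi)^T\qquad\text{(electrically conducting wall)},$$ together with the corresponding manufactured gradient (which does not enter the operator below). Then the visco-resistive dissipation operator $$\mathrm{DISS}^\nu_{(-),(+)}=\hat L\,(\mathbf w_{(+)}-\mathbf w_{(-)}),\qquad\hat L=\beta\,\frac{C^\nu_{(-)}+C^\nu_{(+)}}2,\qquad\beta\ge0,$$ is, in either case, entropy dissipative at the boundary node: its contribution to the time derivative of the discrete entropy satisfies $$\mathbf w_{(-)}^T\,\mathrm{DISS}^\nu_{(-),(+)}\le0 .$$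
   Context: The discretization is written in one space dimension ($x=x_1$; vectors have three components); the wall normal is $\vec n=(1,0,0)$ at a right boundary and $\vec n=(-1,0,0)$ at a left boundary. Perfect gas $p=\rho RT$; constants $\mu_{NS},\mu_R,\kappa,\mu_0>0$. Specific entropy $s=\frac R{\gamma-1}\ln(T/T^* )-R\ln(\rho/\rho^* )$ ($T^*,\rho^*$ reference constants); entropy variables $\mathbf w^T=\left(\frac{\gamma R}{\gamma-1}-s-\frac{\|\vec v\|^2}{2T},\frac{\vec v}T,-\frac1T,\frac{\vec B}{\mu_0T},\frac\psi{\mu_0T}\right)$; $\mathbf w_{(\pm)}$ are those of the interior and ghost states. $C^\nu_{(\pm)}=C^\nu_{11}(\mathbf u_{(\pm)})$, where $C^\nu_{11}(\mathbf u)$ is the symmetric positive semi-definite $9\times9$ matrix such that the one-dimensional visco-resistive flux $$\mathbf f^\nu=\begin{pmatrix}0\\\frac43\mu_{NS}\partial_xv_1\\\mu_{NS}\partial_xv_2\\\mu_{NS}\partial_xv_3\\\mu_{NS}\left(\frac43v_1\partial_xv_1+v_2\partial_xv_2+v_3\partial_xv_3\right)+\kappa\partial_xT+\frac{\mu_R}{\mu_0^2}(B_2\partial_xB_2+B_3\partial_xB_3)\\0\\\frac{\mu_R}{\mu_0}\partial_xB_2\\\frac{\mu_R}{\mu_0}\partial_xB_3\\0\end{pmatrix}$$ equals $C^\nu_{11}(\mathbf u)\,\partial_x\mathbf w$ identically. For completeness, the corresponding manufactured gradients of primitive variables are $(-\theta_{(\rho)},\theta_{(\vec v)},-\theta_{(T)}+2\kappa^{-1}Tg(t)\vec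 n,\theta_{(\vec B)},-\theta_{(\psi)})$ (insulating) and the same with $\theta_{(\vec B)}$ replaced by $\theta_{(\vec B)}^{\,T}+2c_d^{-1}(\vec B^0-\vec B)^T\vec n$ (conducting), where $\theta_{(\cdot)}$ are the interior gradients, $g(t)$ the prescribed heat entropy flux and $c_d$ the wall conductance coefficient. Entropy contribution: in the semi-discrete entropy balance of a DG-SBP-SAT element, the visco-resistive dissipation operator at an end node (state $(-)$) facing a ghost state $(+)$ contributes $\mathbf w_{(-)}^T\mathrm{DISS}^\nu_{(-),(+)}$ to the time derivative of the discrete entropy; ''entropy dissipative'' means this contribution is nonpositive. *)

(* Defs.v *)
From HB Require Import structures.
From mathcomp Require Import all_boot all_order all_algebra ring.
From mathcomp Require Import all_classical all_reals all_analysis.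

Set Implicit Arguments.
Unset Strict Implicit.
Unset Printing Implicit Defensive.

Import Order.TTheory GRing.Theory Num.Theory.
Import numFieldNormedType.Exports.
Local Open Scope ring_scope.

Record mhd_constants (R : realType) := MhdConstants {
  gas_R : R;
  gas_gamma : R;
  mu_NS : R;
  mu_R : R;
  kappa : R;
  mu_0 : R;
  T_ref : R;
  rho_ref : R }.

Definition physical_constants (R : realType) (k : mhd_constants R) : Prop :=
  [/\ [/\ 0 < gas_R k & 1 < gas_gamma k],
      [/\ 0 < mu_NS k, 0 < mu_R k, 0 < kappa k & 0 < mu_0 k],
      0 < T_ref k
    & 0 < rho_ref k].

(* Primitive variables (rho, v, T, B, psi); the state u is represented by them
   throughout. *)
Record prim (R : realType) := Prim {
  pr_rho : R;
  pr_v : 'rV[R]_3;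
  pr_T : R;
  pr_B : 'rV[R]_3;
  pr_psi : R }.

Definition admissible (R : realType) (u : prim R) : Prop :=
  0 < pr_rho u /\ 0 < pr_T u.

(* Gradients of the primitive variables: row i of a vector gradient is the
   gradient of the i-th component. *)
Record prim_grad (R : realType) := PrimGrad {
  gr_rho : 'rV[R]_3;
  gr_v : 'M[R]_3;
  gr_T : 'rV[R]_3;
  gr_B : 'M[R]_3;
  gr_psi : 'rV[R]_3 }.

Definition dot (R : realType) (a b : 'rV[R]_3) : R := (a *m b^T) 0 0.

Definition vec9 (R : realType) (a : R) (u : 'rV[R]_3) (b : R) (w : 'rV[R]_3)
    (c : R) : 'cV[R]_9 :=
  \col_(i < 9) [:: a; u 0 0; u 0 1; u 0 2; b; w 0 0; w 0 1; w 0 2; c]`_i.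

Definition spec_entropy (R : realType) (k : mhd_constants R) (u : prim R) : R :=
  gas_R k / (gas_gamma k - 1) * ln (pr_T u / T_ref k)
  - gas_R k * ln (pr_rho u / rho_ref k).

Definition entropy_vars (R : realType) (k : mhd_constants R) (u : prim R) :
    'cV[R]_9 :=
  vec9 (gas_gamma k * gas_R k / (gas_gamma k - 1) - spec_entropy k u
          - dot (pr_v u) (pr_v u) / (2 * pr_T u))
       ((pr_T u)^-1 *: pr_v u)
       (- (pr_T u)^-1)
       ((mu_0 k * pr_T u)^-1 *: pr_B u)
       (pr_psi u / (mu_0 k * pr_T u)).

(* [du] holds the x-derivatives of the components of [u]. *)
Definition visco_resistive_flux (R : realType) (k : mhd_constants R)
    (u du : prim R) : 'cV[R]_9 :=
  let v := pr_v u in let dv := pr_v du in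
  let B := pr_B u in let dB := pr_B du in
  \col_(i < 9)
   [:: 0;
       4 / 3 * mu_NS k * dv 0 0;
       mu_NS k * dv 0 1;
       mu_NS k * dv 0 2;
       mu_NS k * (4 / 3 * v 0 0 * dv 0 0 + v 0 1 * dv 0 1 + v 0 2 * dv 0 2)
         + kappa k * pr_T du
         + mu_R k / mu_0 k ^+ 2 * (B 0 1 * dB 0 1 + B 0 2 * dB 0 2);
       0;
       mu_R k / mu_0 k * dB 0 1;
       mu_R k / mu_0 k * dB 0 2;
       0]`_i.

Definition derivable_prim (R : realType) (V : R -> prim R) (x : R) : Prop :=
  [/\ derivable (fun y => pr_rho (V y)) x 1,
      derivable (fun y => pr_v (V y)) x 1,
      derivable (fun y => pr_T (V y)) x 1,
      derivable (fun y => pr_B (V y)) x 1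
    & derivable (fun y => pr_psi (V y)) x 1].

Definition deriv_prim (R : realType) (V : R -> prim R) (x : R) : prim R :=
  Prim (derive1 (fun y => pr_rho (V y)) x)
       (derive1 (fun y => pr_v (V y)) x)
       (derive1 (fun y => pr_T (V y)) x)
       (derive1 (fun y => pr_B (V y)) x)
       (derive1 (fun y => pr_psi (V y)) x).

Definition psd (R : realType) (n : nat) (M : 'M[R]_n) : Prop :=
  forall x : 'cV[R]_n, 0 <= (x^T *m M *m x) 0 0.

(* [C u] is the matrix C^nu_11(u).  The flux identity is required along every
   differentiable one-dimensional field of states, with w = entropy_vars. *)
Definition is_visco_resistive_matrix (R : realType) (k : mhd_constants R)
    (C : prim R -> 'M[R]_9) : Prop :=
  forall u : prim R, admissible u ->
    [/\ (C u)^T = C u,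
        psd (C u)
      & forall (V : R -> prim R) (x : R),
          V x = u -> derivable_prim V x ->
          visco_resistive_flux k u (deriv_prim V x)
          = C u *m derive1 (fun y => entropy_vars k (V y)) x].

Record ghost (R : realType) := Ghost {
  gh_state : prim R;
  gh_grad : prim_grad R }.

(* [g] is the value g(t) of the prescribed heat entropy flux. *)
Definition insulating_ghost (R : realType) (k : mhd_constants R) (g : R)
    (n vw B0 : 'rV[R]_3) (u : prim R) (theta : prim_grad R) : ghost R :=
  Ghost
    (Prim (pr_rho u) (- pr_v u + 2 *: vw) (pr_T u) (- pr_B u + 2 *: B0)
          (pr_psi u))
    (PrimGrad (- gr_rho theta) (gr_v theta)
       (- gr_T theta + (2 * (kappa k)^-1 * pr_T u * g) *: n)
       (gr_B theta) (- gr_psi theta)).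

Definition conducting_ghost (R : realType) (k : mhd_constants R) (g cd : R)
    (n vw B0 : 'rV[R]_3) (u : prim R) (theta : prim_grad R) : ghost R :=
  Ghost
    (Prim (pr_rho u) (- pr_v u + 2 *: vw) (pr_T u) (pr_B u) (pr_psi u))
    (PrimGrad (- gr_rho theta) (gr_v theta)
       (- gr_T theta + (2 * (kappa k)^-1 * pr_T u * g) *: n)
       ((gr_B theta)^T + (2 * cd^-1) *: ((B0 - pr_B u)^T *m n))
       (- gr_psi theta)).

Definition visco_resistive_diss (R : realType) (k : mhd_constants R)
    (C : prim R -> 'M[R]_9) (beta : R) (um up : prim R) : 'cV[R]_9 :=
  let L := beta *: (2^-1 *: (C um + C up)) in
  L *m (entropy_vars k up - entropy_vars k um).

(* Contribution of the dissipation operator at the node with state [um] to the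
   time derivative of the discrete entropy. *)
Definition entropy_contribution (R : realType) (k : mhd_constants R)
    (C : prim R -> 'M[R]_9) (beta : R) (um up : prim R) : R :=
  ((entropy_vars k um)^T *m visco_resistive_diss k C beta um up) 0 0.

Definition entropy_dissipative (R : realType) (k : mhd_constants R)
    (C : prim R -> 'M[R]_9) (beta : R) (um up : prim R) : Prop :=
  entropy_contribution k C beta um up <= 0.

(* The remainder shows that is_visco_resistive_matrix is satisfiable: C^nu_11 is
   a sum of rank-one terms coef * (e *m e^T), where e^T *m dw is proportional
   to dv_1, dv_2, dv_3, dT, dB_2 and dB_3 respectively. *)
Definition seq_cV9 (R : realType) (s : seq R) : 'cV[R]_9 := \col_(i < 9) s`_i.

Lemma dot_seq_cV9 (R : realType) (s : seq R) (y : 'cV[R]_9) :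
  ((seq_cV9 s)^T *m y) 0 0 =
  s`_0 * y 0 0 + s`_1 * y 1 0 + s`_2 * y 2 0 + s`_3 * y 3 0 + s`_4 * y 4 0
  + s`_5 * y 5 0 + s`_6 * y 6 0 + s`_7 * y 7 0 + s`_8 * y 8 0.
Proof.
rewrite mxE !big_ord_recl big_ord0 !mxE /= /bump /=.
rewrite addr0 !addrA.
by do ?congr (_ + _); congr (_ * y _ 0); apply/val_inj.
Qed.

Definition C11_terms (R : realType) (k : mhd_constants R) (u : prim R) :
    seq (R * 'cV[R]_9) :=
  let T := pr_T u in let v := pr_v u in let B := pr_B u in
  [:: (4 / 3 * mu_NS k * T, seq_cV9 [:: 0; 1; 0; 0; v 0 0; 0; 0; 0; 0]);
     (mu_NS k * T, seq_cV9 [:: 0; 0; 1; 0; v 0 1; 0; 0; 0; 0]);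
     (mu_NS k * T, seq_cV9 [:: 0; 0; 0; 1; v 0 2; 0; 0; 0; 0]);
     (kappa k * T^+2, seq_cV9 [:: 0; 0; 0; 0; 1; 0; 0; 0; 0]);
     (mu_R k * T, seq_cV9 [:: 0; 0; 0; 0; B 0 1 / mu_0 k; 0; 1; 0; 0]);
     (mu_R k * T, seq_cV9 [:: 0; 0; 0; 0; B 0 2 / mu_0 k; 0; 0; 1; 0])].

Definition C11_explicit (R : realType) (k : mhd_constants R) (u : prim R) :
    'M[R]_9 :=
  \sum_(p <- C11_terms k u) p.1 *: (p.2 *m p.2^T).

Lemma C11_explicit_mul (R : realType) (k : mhd_constants R) u y :
  C11_explicit k u *m y =
  \sum_(p <- C11_terms k u) (p.1 * (p.2^T *m y) 0 0) *: p.2.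
Proof.
rewrite /C11_explicit mulmx_suml; apply: eq_bigr => p _.
rewrite -scalemxAl -mulmxA -scalerA; congr (_ *: _).
by rewrite {1}[p.2^T *m y]mx11_scalar mul_mx_scalar.
Qed.

Lemma C11_explicit_sym (R : realType) (k : mhd_constants R) u :
  (C11_explicit k u)^T = C11_explicit k u.
Proof.
rewrite /C11_explicit linear_sum; apply: eq_bigr => p _ /=.
by rewrite linearZ /= trmx_mul trmxK.
Qed.

Lemma C11_explicit_psd (R : realType) (k : mhd_constants R) u :
  physical_constants k -> admissible u -> psd (C11_explicit k u).
Proof.
move=> hk [_ T0] x; rewrite -mulmxA C11_explicit_mul
  mulmx_sumr summxE.
rewrite big_seq sumr_ge0// => p.
have [_ [a b c d] _ _] := hk.
move=> pin; rewrite -scalemxAr mxE.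
rewrite -mulrA mulr_ge0//.
  move: pin; rewrite !inE => /or4P[|||/or3P[||]] => /eqP -> /=; try apply/ltW;
  rewrite ?mulr_gt0 ?exprn_gt0//.
have -> : (x^T *m p.2) 0 0 = (p.2^T *m x) 0 0.
  by rewrite -[in RHS](trmxK x) -trmx_mul [RHS]mxE.
by rewrite -expr2 sqr_ge0.
Qed.

Lemma flux_C11_explicit (R : realType) (k : mhd_constants R) (u du : prim R)
    (y : 'cV[R]_9) (dTi := - pr_T u ^- 2 * pr_T du) :
  pr_T u != 0 -> mu_0 k != 0 ->
  y 1 0 = (pr_T u)^-1 * pr_v du 0 0 + pr_v u 0 0 * dTi ->
  y 2 0 = (pr_T u)^-1 * pr_v du 0 1 + pr_v u 0 1 * dTi ->
  y 3 0 = (pr_T u)^-1 * pr_v du 0 2 + pr_v u 0 2 * dTi ->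
  y 4 0 = - dTi ->
  y 6 0 = (mu_0 k)^-1 * ((pr_T u)^-1 * pr_B du 0 1 + pr_B u 0 1 * dTi) ->
  y 7 0 = (mu_0 k)^-1 * ((pr_T u)^-1 * pr_B du 0 2 + pr_B u 0 2 * dTi) ->
  visco_resistive_flux k u du = C11_explicit k u *m y.
Proof.
rewrite {}/dTi => Tn mn y1 y2 y3 y4 y6 y7.
rewrite C11_explicit_mul /C11_terms !big_cons big_nil !dot_seq_cV9 /=.
rewrite {}y1 {}y2 {}y3 {}y4 {}y6 {}y7.
case: u Tn => r v T B p /= Tn; case: du => r' v' T' B' p' /=.
apply/matrixP => i j; rewrite (ord1 j) {j} !mxE.
by case: i => [[|[|[|[|[|[|[|[|[|//]]]]]]]]] hi] /=; field; rewrite ?Tn ?mn.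
Qed.

Lemma eq_derivable (R : realType) (f g : R -> R) x :
  (forall y, f y = g y) -> derivable f x 1 -> derivable g x 1.
Proof. by move=> /funext ->. Qed.

Lemma derivable_vec9 (R : realType) (a b c : R -> R) (u w : R -> 'rV[R]_3) x :
  derivable a x 1 -> (forall i, derivable (fun y => u y 0 i) x 1) ->
  derivable b x 1 -> (forall i, derivable (fun y => w y 0 i) x 1) ->
  derivable c x 1 ->
  derivable (fun y => vec9 (a y) (u y) (b y) (w y) (c y)) x 1.
Proof.
move=> da du db dw dc; apply/derivable_mxP => i j.
under eq_fun do rewrite mxE; case: i => i /=.
case: i => [_|i]; first exact: da.
do 3![case: i => [_|i]; first exact: du].
case: i => [_|i]; first exact: db.
do 3![case: i => [_|i]; first exact: dw].
case: i => [_|i Hi]; first exact: dc.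
by exfalso; move: Hi.
Qed.

Lemma vec9_1 (R : realType) (a b c : R) (u w : 'rV[R]_3) :
  vec9 a u b w c 1 0 = u 0 0.
Proof. by rewrite mxE. Qed.

Lemma vec9_2 (R : realType) (a b c : R) (u w : 'rV[R]_3) :
  vec9 a u b w c 2 0 = u 0 1.
Proof. by rewrite mxE. Qed.

Lemma vec9_3 (R : realType) (a b c : R) (u w : 'rV[R]_3) :
  vec9 a u b w c 3 0 = u 0 2.
Proof. by rewrite mxE. Qed.

Lemma vec9_4 (R : realType) (a b c : R) (u w : 'rV[R]_3) :
  vec9 a u b w c 4 0 = b.
Proof. by rewrite mxE. Qed.

Lemma vec9_6 (R : realType) (a b c : R) (u w : 'rV[R]_3) :
  vec9 a u b w c 6 0 = w 0 1.
Proof. by rewrite mxE. Qed.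

Lemma vec9_7 (R : realType) (a b c : R) (u w : 'rV[R]_3) :
  vec9 a u b w c 7 0 = w 0 2.
Proof. by rewrite mxE. Qed.

Lemma visco_resistive_matrix_exists (R : realType) (k : mhd_constants R) :
  physical_constants k ->
  exists C : prim R -> 'M[R]_9, is_visco_resistive_matrix k C.
Proof.
move=> hk; exists (C11_explicit k) => u au.
split; [exact: C11_explicit_sym|exact: C11_explicit_psd|].
move=> V x Vx [d1 d2 d3 d4 d5].
have [[R0 g1] [a b c d] Tr0 rr0] := hk.
have [r0 T0] : admissible (V x) by rewrite Vx.
have D1 (f : R -> R) : derivable f x 1 -> is_derive x 1 f ('D_1 f x).
  by move=> h; exact: DeriveDef.
have d2i i : derivable (fun y => pr_v (V y) 0 i) x 1.
  by move/derivable_mxP: d2; apply.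
have d4i i : derivable (fun y => pr_B (V y) 0 i) x 1.
  by move/derivable_mxP: d4; apply.
have Tn : pr_T (V x) != 0 by rewrite gt_eqF.
have mn : mu_0 k != 0 by rewrite gt_eqF.
pose Ti := fun y => (pr_T (V y))^-1.
pose dTi := - pr_T (V x) ^- 2 * 'D_1 (fun y => pr_T (V y)) x.
have dT : is_derive x 1 Ti dTi.
  exact: is_deriveV Tn (D1 _ d3).
have dl (h : R -> R) (cc : R) : derivable h x 1 -> 0 < h x -> 0 < cc ->
   derivable (fun y => ln (h y / cc)) x 1.
  move=> dh h0 c0.
  have H1 : is_derive x 1 (h * cst cc^-1) ('D_1 (h * cst cc^-1) x).
    exact: D1 _ (derivableM dh (derivable_cst cc^-1 x 1)).
  have H2 := @is_derive1_ln R ((h * cst cc^-1) x) (divr_gt0 h0 c0).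
  by have [] := is_derive1_comp H2.
set W := fun y => entropy_vars k (V y).
have dv i : is_derive x 1 (fun y => Ti y * pr_v (V y) 0 i)
  (Ti x * 'D_1 (fun y => pr_v (V y) 0 i) x + pr_v (V x) 0 i * dTi).
  by have := is_deriveM dT (D1 _ (d2i i)).
pose mi := (mu_0 k)^-1.
have dB i : is_derive x 1 (fun y => (mu_0 k * pr_T (V y))^-1 * pr_B (V y) 0 i)
  (mi * (Ti x * 'D_1 (fun y => pr_B (V y) 0 i) x + pr_B (V x) 0 i * dTi)).
  have := is_deriveZ mi (is_deriveM dT (D1 _ (d4i i))).
  congr (is_derive _ _ _ _); apply/funext => y; rewrite /Ti/mi /=.
  by rewrite invfM -mulrA.
have dp : derivable (fun y => pr_psi (V y) / (mu_0 k * pr_T (V y))) x 1.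
  have -> : (fun y => pr_psi (V y) / (mu_0 k * pr_T (V y))) =
      mi \*: (Ti * (fun y => pr_psi (V y))).
    apply/funext => y; rewrite invfM mulrC -mulrA.
    by rewrite /mi /Ti.
  have [dTi' _] := dT; exact: derivableZ (derivableM dTi' d5).
have dW : derivable W x 1.
  apply: derivable_vec9.
  - have H1 := derivableM (derivable_cst (gas_R k / (gas_gamma k - 1)) x 1)
      (dl _ _ d3 T0 Tr0).
    have H2 := derivableM (derivable_cst (gas_R k) x 1)
      (dl _ _ d1 r0 rr0).
    have H3 := derivableB (derivable_cst (gas_gamma k * gas_R k / (gas_gamma k - 1)) x 1)
      (derivableB H1 H2).
    have vv i := derivableM (d2i i) (d2i i).
    have [Ti' _] := dT.
    have H4 := derivableM (derivable_sum vv) (derivableZ (k := 2^-1) Ti').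
    have := derivableB H3 H4.
    apply: eq_derivable => y.
    rewrite /spec_entropy /dot !fctE fct_sumE mxE invfM; congr (_ - _ * _).
    by apply: eq_bigr => i _; rewrite mxE.
  - move=> i; have [+ _] := dv i; apply: eq_derivable => y.
    by rewrite mxE.
  - have [+ _] := is_deriveN dT; exact: eq_derivable.
  - move=> i; have [+ _] := dB i; apply: eq_derivable => y.
    by rewrite mxE.
  - exact: dp.
set w := derive1 _ x.
have wE i : w i 0 = 'D_1 (fun y => W y i 0) x.
  by rewrite /w derive1E (derive_mx dW) mxE.
have w1 : w 1 0 =
    Ti x * 'D_1 (fun y => pr_v (V y) 0 0) x + pr_v (V x) 0 0 * dTi.
  rewrite wE -(@derive_val _ _ _ _ _ _ _ (dv 0)); congr ('D_1 _ x).
  apply/funext => y.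
  by rewrite /W /entropy_vars vec9_1 mxE.
have w2 : w 2 0 =
    Ti x * 'D_1 (fun y => pr_v (V y) 0 1) x + pr_v (V x) 0 1 * dTi.
  rewrite wE -(@derive_val _ _ _ _ _ _ _ (dv 1)); congr ('D_1 _ x).
  apply/funext => y.
  by rewrite /W /entropy_vars vec9_2 mxE.
have w3 : w 3 0 =
    Ti x * 'D_1 (fun y => pr_v (V y) 0 2) x + pr_v (V x) 0 2 * dTi.
  rewrite wE -(@derive_val _ _ _ _ _ _ _ (dv 2)); congr ('D_1 _ x).
  apply/funext => y.
  by rewrite /W /entropy_vars vec9_3 mxE.
have w4 : w 4 0 = - dTi.
  rewrite wE -(@derive_val _ _ _ _ _ _ _ (is_deriveN dT)); congr ('D_1 _ x).
  apply/funext => y.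
  by rewrite /W /entropy_vars vec9_4.
have w6 : w 6 0 =
    mi * (Ti x * 'D_1 (fun y => pr_B (V y) 0 1) x + pr_B (V x) 0 1 * dTi).
  rewrite wE -(@derive_val _ _ _ _ _ _ _ (dB 1)); congr ('D_1 _ x).
  apply/funext => y.
  by rewrite /W /entropy_vars vec9_6 mxE.
have w7 : w 7 0 =
    mi * (Ti x * 'D_1 (fun y => pr_B (V y) 0 2) x + pr_B (V x) 0 2 * dTi).
  rewrite wE -(@derive_val _ _ _ _ _ _ _ (dB 2)); congr ('D_1 _ x).
  apply/funext => y.
  by rewrite /W /entropy_vars vec9_7 mxE.
have dvE i : (derive1 (fun y => pr_v (V y)) x) 0 i =
    'D_1 (fun y => pr_v (V y) 0 i) x.
  by rewrite derive1E (derive_mx d2) mxE.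
have dBE i : (derive1 (fun y => pr_B (V y)) x) 0 i =
    'D_1 (fun y => pr_B (V y) 0 i) x.
  by rewrite derive1E (derive_mx d4) mxE.
rewrite -Vx; apply: (flux_C11_explicit Tn mn).
- rewrite w1 -dvE /dTi -derive1E; exact: erefl.
- rewrite w2 -dvE /dTi -derive1E; exact: erefl.
- rewrite w3 -dvE /dTi -derive1E; exact: erefl.
- rewrite w4 /dTi -derive1E; exact: erefl.
- rewrite w6 -dBE /dTi -derive1E; exact: erefl.
- rewrite w7 -dBE /dTi -derive1E; exact: erefl.
Qed.

(* Main.v *)
(* T and psi are the same on both sides of the wall, so the jump w_(+) - w_(-) is,
   at either state, the derivative of w along a curve of states with constant T
   and psi; its first component is matched by varying the density.  The flux
   identity along that curve evaluates C^nu times the jump, and pairing with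
   w_(-) gives 0 at the interior state and minus a weighted sum of squares of the
   jumps of v and B at the ghost state. *)

Require Import Defs.
From HB Require Import structures.
From mathcomp Require Import all_boot all_order all_algebra ring.
From mathcomp Require Import all_classical all_reals all_analysis.

Set Implicit Arguments.
Unset Strict Implicit.
Unset Printing Implicit Defensive.

Import Order.TTheory GRing.Theory Num.Theory.
Import numFieldNormedType.Exports.
Local Open Scope ring_scope.

Lemma dotE (R : realType) (a b : 'rV[R]_3) :
  dot a b = a 0 0 * b 0 0 + a 0 1 * b 0 1 + a 0 2 * b 0 2.
Proof.
rewrite /dot mxE !big_ord_recl big_ord0 !mxE addr0 !addrA.
by do ?congr (_ + _); congr (a _ _ * b _ _); apply/val_inj.
Qed.

Lemma dot_vec9 (R : realType) (a b c : R) (u w : 'rV[R]_3) (y : 'cV[R]_9) :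
  ((vec9 a u b w c)^T *m y) 0 0 =
  a * y 0 0 + u 0 0 * y 1 0 + u 0 1 * y 2 0 + u 0 2 * y 3 0 + b * y 4 0
  + w 0 0 * y 5 0 + w 0 1 * y 6 0 + w 0 2 * y 7 0 + c * y 8 0.
Proof. exact: dot_seq_cV9. Qed.

(** Stated over a normed module so as to serve both the velocity and magnetic rows of a state and
    the column of entropy variables. *)
Lemma is_derive_affine (R : realType) (V : normedModType R) (a b : V) (x : R) :
  is_derive x 1 (fun y : R => a + y *: b) b.
Proof.
have dxb : is_derive x 1 ( *:%R ^~ b : R -> V) b.
  apply: DeriveDef; first exact/diff_derivable.
  by rewrite deriveE// diff_val scale1r.
by have := is_deriveD (is_derive_cst a x 1) dxb; rewrite add0r.
Qed.

(* The exponent of the density makes the entropy variables affine in x. *)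
Definition isothermal_curve (R : realType) (k : mhd_constants R) (u : prim R)
    (a : R) (dv dB : 'rV[R]_3) (x : R) : prim R :=
  Prim (pr_rho u * expR ((x * (a + dot (pr_v u) dv / pr_T u)
                          + x ^+ 2 * (dot dv dv / (2 * pr_T u))) / gas_R k))
       (pr_v u + x *: dv) (pr_T u) (pr_B u + x *: dB) (pr_psi u).

(** The first entry contains [gas_R k] times the logarithm of the density, so the exponent of the
    density is added to it up to that factor. The terms in [dot (pr_v u) dv] and [dot dv dv] cancel
    the change of the kinetic term, which leaves [x * a]. *)
Lemma entropy_vars_isothermal_curve (R : realType) (k : mhd_constants R)
    (u : prim R) (a : R) (dv dB : 'rV[R]_3) (x : R) :
  physical_constants k -> admissible u ->
  entropy_vars k (isothermal_curve k u a dv dB x) =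
  entropy_vars k u
  + x *: vec9 a ((pr_T u)^-1 *: dv) 0 ((mu_0 k * pr_T u)^-1 *: dB) 0.
Proof.
move=> [[R0 g1] [_ _ _ m0] _ r0] [ru0 T0].
have Rn : gas_R k != 0 by rewrite gt_eqF.
have Tn : pr_T u != 0 by rewrite gt_eqF.
have mn : mu_0 k != 0 by rewrite gt_eqF.
have gn : gas_gamma k - 1 != 0 by rewrite subr_eq0 gt_eqF.
have lnE z : ln (pr_rho u * expR z / rho_ref k) = ln (pr_rho u / rho_ref k) + z.
  by rewrite mulrAC (@lnM _ (pr_rho u / rho_ref k)) ?posrE ?expR_gt0 ?divr_gt0// expRK.
rewrite /entropy_vars /spec_entropy /= lnE !dotE.
apply/matrixP => i j; rewrite (ord1 j) {j} !mxE.
case: i => [[|[|[|[|[|[|[|[|[|//]]]]]]]]] hi] /=; rewrite ?mxE; last by ring.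
all: by field; rewrite ?Rn ?Tn ?mn ?gn.
Qed.

(** [C] is known only through the flux identity along curves, so the vector is realised as the
    derivative of the entropy variables along [isothermal_curve] at 0. The flux contains no density
    derivative, hence [a] disappears. *)
Lemma visco_resistive_matrix_isothermal (R : realType) (k : mhd_constants R)
    (C : prim R -> 'M[R]_9) (u : prim R) (a : R) (dv dB : 'rV[R]_3) :
  physical_constants k -> is_visco_resistive_matrix k C -> admissible u ->
  C u *m vec9 a ((pr_T u)^-1 *: dv) 0 ((mu_0 k * pr_T u)^-1 *: dB) 0 =
  visco_resistive_flux k u (Prim 0 dv 0 dB 0).
Proof.
move=> hk hC hu; have [_ _ flux] := hC _ hu.
pose V := isothermal_curve k u a dv dB.
have V0 : V 0 = u.
  rewrite /V /isothermal_curve expr0n /= !mul0r addr0 mul0r expR0 mulr1.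
  by rewrite !scale0r !addr0; case: (u).
have dVv := is_derive_affine (pr_v u) dv 0.
have dVB := is_derive_affine (pr_B u) dB 0.
have dV : derivable_prim V 0.
  split; [|by case: dVv|exact: derivable_cst|by case: dVB|exact: derivable_cst].
  pose c := a + dot (pr_v u) dv / pr_T u.
  pose d := dot dv dv / (2 * pr_T u).
  (* The exponent of the density, in the pointwise form to which the derivability rules apply. *)
  pose q := (id * cst c + id ^+ 2 * cst d) * cst (gas_R k)^-1 : R -> R.
  have dc (e : R) : derivable (cst e : R -> R) 0 1 by exact: derivable_cst.
  have di : derivable (id : R -> R) 0 1 by exact: derivable_id.
  have dq : derivable q 0 1.
    exact: derivableM (derivableD (derivableM di (dc c))
      (derivableM (@derivableX _ _ id 2 _ _ di) (dc d))) (dc _).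
  have [dexp _] := is_derive1_comp (is_derive_expR (q 0)) (DeriveDef dq erefl).
  rewrite (_ : (fun y => _) = cst (pr_rho u) * (expR \o q)).
    exact: derivableM (dc _) dexp.
  by apply/funext => y; rewrite /V /q /c /d /= !fctE.
have := flux V 0 V0 dV.
rewrite (_ : (fun y => entropy_vars k (V y)) = fun y => entropy_vars k u + y *:
  vec9 a ((pr_T u)^-1 *: dv) 0 ((mu_0 k * pr_T u)^-1 *: dB) 0); last first.
  by apply/funext => y; exact: entropy_vars_isothermal_curve.
rewrite derive1E (@derive_val _ _ _ _ _ _ _ (is_derive_affine _ _ _)) => <-.
rewrite /visco_resistive_flux /deriv_prim /= !derive1E.
rewrite (@derive_val _ _ _ _ _ _ _ dVv) (@derive_val _ _ _ _ _ _ _ dVB).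
by rewrite derive_cst.
Qed.

(** Two states occur because the ghost half of the averaged matrix is paired with the interior
    entropy variables. The energy row, weighted by [- (pr_T u)^-1], subtracts the velocity and field
    of [u'] from those of [u]. *)
Lemma entropy_vars_dot_flux (R : realType) (k : mhd_constants R)
    (u u' : prim R) (dv dB : 'rV[R]_3) :
  physical_constants k -> admissible u ->
  ((entropy_vars k u)^T *m
     visco_resistive_flux k u' (Prim 0 dv 0 dB 0)) 0 0 =
  mu_NS k / pr_T u *
    (4 / 3 * ((pr_v u 0 0 - pr_v u' 0 0) * dv 0 0)
     + (pr_v u 0 1 - pr_v u' 0 1) * dv 0 1
     + (pr_v u 0 2 - pr_v u' 0 2) * dv 0 2)
  + mu_R k / (mu_0 k ^+ 2 * pr_T u) *
    ((pr_B u 0 1 - pr_B u' 0 1) * dB 0 1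
     + (pr_B u 0 2 - pr_B u' 0 2) * dB 0 2).
Proof.
move=> [[_ g1] [_ _ _ m0] _ _] [_ T0].
have Tn : pr_T u != 0 by rewrite gt_eqF.
have mn : mu_0 k != 0 by rewrite gt_eqF.
have gn : gas_gamma k - 1 != 0 by rewrite subr_eq0 gt_eqF.
rewrite dot_vec9 !mxE /=.
by field; rewrite Tn mn gn.
Qed.

Lemma isothermal_entropy_dissipative (R : realType) (k : mhd_constants R)
    (C : prim R -> 'M[R]_9) (beta : R) (um up : prim R) :
  physical_constants k -> is_visco_resistive_matrix k C -> 0 <= beta ->
  admissible um -> admissible up ->
  pr_T up = pr_T um -> pr_psi up = pr_psi um ->
  entropy_dissipative k C beta um up.
Proof.
move=> hk hC hbeta hum hup eT epsi.
have [_ [mNS0 mR0 _ m0] _ _] := hk; have [_ T0] := hum.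
pose dv := pr_v up - pr_v um; pose dB := pr_B up - pr_B um.
have [a jumpE] : exists a, entropy_vars k up - entropy_vars k um =
    vec9 a ((pr_T um)^-1 *: dv) 0 ((mu_0 k * pr_T um)^-1 *: dB) 0.
  (* Any first entry will do, since [a] is free in the isothermal lemma. *)
  exists (entropy_vars k up 0 0 - entropy_vars k um 0 0).
  apply/matrixP => i j; rewrite (ord1 j) {j} !mxE.
  case: i => [[|[|[|[|[|[|[|[|[|//]]]]]]]]] hi] //=;
    rewrite ?mxE ?eT ?epsi; ring.
rewrite /entropy_dissipative /entropy_contribution /visco_resistive_diss jumpE.
rewrite -!scalemxAl -!scalemxAr mxE mxE mulmxDl mulmxDr mxE.
rewrite (visco_resistive_matrix_isothermal _ _ _ hk hC hum).
(* Equal temperatures put the same jump vector in the form required at the ghost state. *)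
rewrite -eT (visco_resistive_matrix_isothermal _ _ _ hk hC hup).
rewrite !entropy_vars_dot_flux//.
have dvE i : pr_v um 0 i - pr_v up 0 i = - dv 0 i by rewrite !mxE opprB.
have dBE i : pr_B um 0 i - pr_B up 0 i = - dB 0 i by rewrite !mxE opprB.
(* The interior half vanishes by [subrr]; the ghost half keeps minus the squares of the jumps. *)
rewrite !dvE !dBE !subrr !mul0r !mulr0 !addr0 !mulr0 !add0r.
rewrite mulr_ge0_le0// mulr_ge0_le0// ?invr_ge0//.
rewrite !mulNr mulrN -!opprD !mulrN -opprD oppr_le0 -!expr2.
have mT0 : 0 < mu_0 k ^+ 2 * pr_T um by rewrite mulr_gt0 ?exprn_gt0.
by do ?[exact: sqr_ge0|apply: addr_ge0|apply: mulr_ge0];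
  rewrite ?invr_ge0 ?ler0n// ltW.
Qed.

Theorem theorem7 (R : realType) (k : mhd_constants R)
  (hk : physical_constants k)
  (C : prim R -> 'M[R]_9) (hC : is_visco_resistive_matrix k C)
  (beta : R) (hbeta : 0 <= beta)
  (um : prim R) (hum : admissible um)
  (n : 'rV[R]_3) (hn : n = delta_mx 0 0 \/ n = - delta_mx 0 0)
  (vw : 'rV[R]_3) (hvw : dot vw n = 0)
  (B0 : 'rV[R]_3)
  (theta : prim_grad R) (g : R -> R) (t : R) :
  entropy_dissipative k C beta um
    (gh_state (insulating_ghost k (g t) n vw B0 um theta))
  /\ forall (cd : R) (hcd : cd != 0),
       entropy_dissipative k C beta um
         (gh_state (conducting_ghost k (g t) cd n vw B0 um theta)).
Proof.
(* Both ghost states keep density, temperature and [psi], so the side conditions hold by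
   computation. *)
by split=> [|cd _]; apply: isothermal_entropy_dissipative.
Qed.
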